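(* Let $f\colon X\to X$ be a homeomorphism of a compact topological space $X$, $R$ an equivalence relation on $X$ compatible with $f$, $X_R=X/R$ the quotient space and $f_R\colon X_R\to X_R$ the induced homeomorphism. Then the following conditions are equivalent. (1) $f_R$ is expansive. (2) There is a finite open cover $\mathcal U$ of $X$ such that $f$ is $\mathcal U$-semi expansive and $R=R(\mathcal U)$.
   Context: $X$ is not assumed metrizable. An equivalence relation $R$ on $X$ (written $x\sim y$) is compatible with $f$ if for all $x,y\in X$: $x\sim y$ if and only if $f(x)\sim f(y)$. $X/R$ carries the quotient topology and $f_R[x]=[f(x)]$. A homeomorphism $g\colon Y\to Y$ of a compact topological space $Y$ is expansive if $Y$ is metrizable and, for some (equivalently, any) metric $\rho$ inducing the topology of $Y$, there is $\alpha>0$ such that: $x,y\in Y$ and $\rho(g^n x,g^n y)\le\alpha$ for all $n\in\mathbb Z$ implies $x=y$. For a collection $\mathcal C$ of subsets of $X$ and $A\subseteq X$, $A\prec\mathcal C$ means $A\subseteq C$ for some $C\in\mathcal C$. For a cover $\mathcal C$ of $X$, $R(\mathcal C)\subseteq X\times X$ is the (reflexive and symmetric) relation $\{(x,y): \{f^nx,f^ny\}\prec\mathcal C\text{ for all }n\in\mathbb Z\}$. For a collection $\mathcal C$ of subsets of $X$, $\overline{\mathcal C}=\{\overline C: C\in\mathcal C\}$ (closures), and for $k\in\mathbb N$, $\mathcal C^k=\{C_1\cup\cdots\cup C_k: C_1,\dots,C_k\in\mathcal C,\ C_i\cap C_{i+1}\ne\varnothing\text{ for }1\le i<k\}$. In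 particular $\overline{\mathcal U}^4=(\overline{\mathcal U})^4$. For a finite open cover $\mathcal U$ of $X$, $f$ is $\mathcal U$-semi expansive if $R(\overline{\mathcal U}^4)\subseteq R(\mathcal U)$. *)

(* Defs.v *)
From HB Require Import structures.
From mathcomp Require Import all_boot all_order all_algebra.
From mathcomp Require Import all_classical all_reals all_analysis.
Set Implicit Arguments.
Unset Strict Implicit.
Unset Printing Implicit Defensive.
Import Order.TTheory GRing.Theory Num.Theory.
Local Open Scope classical_set_scope.
Local Open Scope ring_scope.
Local Open Scope quotient_scope.

Record homeo (X Y : topologicalType) := Homeo {
  homeo_fun :> X -> Y;
  homeo_inv : Y -> X;
  homeoK : cancel homeo_fun homeo_inv;
  homeoVK : cancel homeo_inv homeo_fun;
  homeo_continuous : continuous homeo_fun;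
  homeoV_continuous : continuous homeo_inv }.

(* [Negz k] is the integer - k.+1. *)
Definition zpow (X : topologicalType) (f : homeo X X) (n : int) : X -> X :=
  match n with
  | Posz k => iter k f
  | Negz k => iter k.+1 (homeo_inv f)
  end.

Record is_metric (K : realType) (Y : Type) (d : Y -> Y -> K) : Prop := {
  metric_ge0 : forall x y, 0 <= d x y;
  metric_eq0 : forall x y, d x y = 0 <-> x = y;
  metric_sym : forall x y, d x y = d y x;
  metric_triangle : forall x y z, d x z <= d x y + d y z }.

Definition induces_topology (K : realType) (Y : topologicalType)
    (d : Y -> Y -> K) : Prop :=
  forall A : set Y, open A <->
    forall x, A x -> exists2 e : K, 0 < e & [set y | d x y < e] `<=` A.

Definition expansive (K : realType) (Y : topologicalType) (g : homeo Y Y) :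
    Prop :=
  exists d : Y -> Y -> K, [/\ is_metric d, induces_topology d &
    exists2 alpha : K, 0 < alpha &
      forall x y, (forall n : int, d (zpow g n x) (zpow g n y) <= alpha) ->
        x = y].

Definition refines_into (X : Type) (A : set X) (C : set (set X)) : Prop :=
  exists2 B, C B & A `<=` B.

Definition cover_rel (X : topologicalType) (f : homeo X X) (C : set (set X))
    (x y : X) : Prop :=
  forall n : int, refines_into [set zpow f n x; zpow f n y] C.

(* The unions of chains C 0, ..., C k.-1 of members of CC in which consecutive
   members meet; only the values C i with i < k matter. *)
Definition chain_pow (X : Type) (CC : set (set X)) (k : nat) : set (set X) :=
  [set B | exists C : nat -> set X,
    [/\ forall i, (i < k)%N -> CC (C i),
        forall i, (i.+1 < k)%N -> C i `&` C i.+1 !=set0 &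
        B = \bigcup_(i < k) C i]].

Definition closures (X : topologicalType) (C : set (set X)) : set (set X) :=
  [set closure B | B in C].

Definition finite_open_cover (X : topologicalType) (U : set (set X)) : Prop :=
  [/\ finite_set U, forall A, U A -> open A & cover U id = [set: X]].

Definition semi_expansive (X : topologicalType) (f : homeo X X)
    (U : set (set X)) : Prop :=
  forall x y, cover_rel f (chain_pow (closures U) 4) x y -> cover_rel f U x y.

Definition compatible (X : topologicalType) (f : homeo X X) (R : equiv_rel X) :
    Prop :=
  forall x y, R x y <-> R (f x) (f y).

Notation quot_space R := (quotient_topology {eq_quot R}).

Section QuotientHomeo.
Variables (X : topologicalType) (f : homeo X X) (R : equiv_rel X).
Hypothesis fR : compatible f R.

Local Notation Q := (quot_space R).

Lemma quot_spaceP (x y : X) : (\pi_Q x = \pi_Q y) <-> R x y.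
Proof. by split => [/eqquotP|xy]; [|apply/eqquotP]. Qed.

Definition quot_fun (q : Q) : Q := \pi_Q (f (repr q)).
Definition quot_inv (q : Q) : Q := \pi_Q (homeo_inv f (repr q)).

Lemma quot_funE x : quot_fun (\pi_Q x) = \pi_Q (f x).
Proof.
by apply/quot_spaceP; apply: (fR _ _).1; apply/quot_spaceP; rewrite reprK.
Qed.

Lemma quot_invE x : quot_inv (\pi_Q x) = \pi_Q (homeo_inv f x).
Proof.
by apply/quot_spaceP; apply: (fR _ _).2; rewrite !homeoVK; apply/quot_spaceP;
  rewrite reprK.
Qed.

Lemma quot_funK : cancel quot_fun quot_inv.
Proof. by move=> q; rewrite -[q]reprK quot_funE quot_invE homeoK. Qed.

Lemma quot_invK : cancel quot_inv quot_fun.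
Proof. by move=> q; rewrite -[q]reprK quot_invE quot_funE homeoVK. Qed.

Lemma quot_fun_continuous : continuous quot_fun.
Proof.
apply/quotient_continuous.
rewrite (_ : _ \o _ = \pi_Q \o f); last by apply/funext => x; exact: quot_funE.
by move=> x; apply: continuous_comp;
  [exact: homeo_continuous|exact: pi_continuous].
Qed.

Lemma quot_inv_continuous : continuous quot_inv.
Proof.
apply/quotient_continuous.
rewrite (_ : _ \o _ = \pi_Q \o homeo_inv f); last first.
  by apply/funext => x; exact: quot_invE.
by move=> x; apply: continuous_comp;
  [exact: homeoV_continuous|exact: pi_continuous].
Qed.

Definition quot_homeo : homeo Q Q :=
  Homeo quot_funK quot_invK quot_fun_continuous quot_inv_continuous.

End QuotientHomeo.

(* Main.v *)
Require Import Defs.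
From HB Require Import structures.
From mathcomp Require Import all_boot all_order all_algebra finmap.
From mathcomp Require Import all_classical all_reals all_analysis.
From mathcomp Require Import zify lra.

(**
(1) => (2): pull back to X a finite cover of X/R by balls of radius alpha/8;
a chain of four closures of its members has image of diameter at most alpha.

(2) => (1): by compactness of X * X there is N such that x, y lie in a common
member of U as soon as f^n x, f^n y lie in a common chain of four closures for
all |n| <= N.  Hence the open relations "f^n x and f^n y lie in a common member
of U for all |n| <= k N" satisfy E_(k+1) o E_(k+1) o E_(k+1) <= E_k, and their
intersection is R.  Frink's metrization lemma turns them into a continuous
pseudometric on X vanishing exactly on R; the induced metric on the compact
space X/R is compatible with its topology, and f_R is expansive for it because
a small distance forces membership in a common element of U.
*)

Import Order.TTheory GRing.Theory Num.Theory.
Local Open Scope classical_set_scope.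
Local Open Scope ring_scope.
Local Open Scope quotient_scope.
Set Implicit Arguments.
Unset Strict Implicit.

(** * Frink's chain pseudometric for a sequence of entourages *)

Section Frink.
Variables (K : realType) (T : Type) (E : nat -> T -> T -> Prop).
Hypotheses (E_refl : forall k x, E k x x)
  (E_sym : forall k x y, E k x y -> E k y x)
  (E_comp3 : forall k x y z w,
    E k.+1 x y -> E k.+1 y z -> E k.+1 z w -> E k x w)
  (E_total : forall x y, E 0 x y).

(** A pair in the list records the level of a step and the point it reaches. *)
Fixpoint chain (x : T) (s : seq (nat * T)) (y : T) : Prop :=
  if s is p :: s' then E p.1 x p.2 /\ chain p.2 s' y else x = y.

Definition cost (s : seq (nat * T)) : K := \sum_(p <- s) 2^-1 ^+ p.1.

Definition chain_dist (x y : T) : K :=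
  inf [set cost s | s in [set s | chain x s y]].

Lemma chain_cat x y z s t : chain x s y -> chain y t z -> chain x (s ++ t) z.
Proof.
by elim: s x => [x <-//|p s IHs x /= [xp py] yz]; split=> //; exact: IHs.
Qed.

Lemma chain_catE x z s t :
  chain x (s ++ t) z -> exists2 y, chain x s y & chain y t z.
Proof.
elim: s x => [x xz|p s IHs x /= [xp /IHs[y py yz]]]; first by exists x.
by exists y.
Qed.

Lemma cost_cat s t : cost (s ++ t) = cost s + cost t.
Proof. exact: big_cat. Qed.

Lemma cost_cons p s : cost (p :: s) = 2^-1 ^+ p.1 + cost s.
Proof. exact: big_cons. Qed.

Lemma cost_nil : cost [::] = 0. Proof. exact: big_nil. Qed.

Lemma cost_ge0 s : 0 <= cost s.
Proof. by apply: sumr_ge0 => p _; rewrite exprn_ge0. Qed.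

Lemma chain_rev x y s :
  chain x s y -> exists2 t, chain y t x & cost t = cost s.
Proof.
elim: s x => [x /= ->|p s IHs x /= [xp /IHs[t yt tE]]]; first by exists [::].
exists (t ++ [:: (p.1, x)]).
  by apply: chain_cat yt _; split=> //=; exact: E_sym.
by rewrite cost_cat !cost_cons cost_nil tE addr0 addrC.
Qed.

Lemma entourage_sub k j x y : (k <= j)%N -> E j x y -> E k x y.
Proof.
move=> /subnK <-; elim: (j - k)%N => // n IHn.
by rewrite addSn => xy; apply: IHn; exact: E_comp3 xy (E_refl _ _) (E_refl _ _).
Qed.

(** Induction on the list, lowering the threshold by the cost of each step passed. The step [p] is
    the first to reach the threshold, or the last one if none does. *)
Lemma chain_split s (t : K) : s <> [::] -> 0 < t ->
  exists s1 p s2, [/\ s = s1 ++ p :: s2, cost s1 < t &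
    s2 = [::] \/ t <= cost s1 + 2^-1 ^+ p.1].
Proof.
elim: s t => // p [_ t _ t0|q s IHs t _ t0].
  by exists [::], p, [::]; rewrite cost_nil; split=> //; left.
have [tp|pt] := leP t (2^-1 ^+ p.1).
  by exists [::], p, (q :: s); rewrite cost_nil add0r; split=> //; right.
have [//||s1 [r [s2 [-> s1t rt]]]] := IHs (t - 2^-1 ^+ p.1).
  by rewrite subr_gt0.
exists (p :: s1), r, s2; rewrite cost_cons; split=> //; first by lra.
by case: rt => [->|rt]; [left|right; lra].
Qed.

(* A chain of cost less than [2^-k] is cut at the longest prefix of cost less
   than [2^-(k+1)]: the step that follows and the remaining suffix then also
   cost at most, resp. less than, [2^-(k+1)], and [E_comp3] applies. *)
Lemma chain_entourage k x y s : chain x s y -> cost s < 2^-1 ^+ k -> E k x y.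
Proof.
have [n] := ubnP (size s); elim: n s k x y => // n IHn s k x y sn.
have [->/= -> _//|s0 xy sk] := pselect (s = [::]).
have half0 m : 0 < 2^-1 ^+ m :> K by rewrite exprn_gt0.
have [s1 [p [s2 [sE s1k s2k]]]] := chain_split s0 (half0 k.+1).
move: xy sk sn; rewrite {s s0}sE => /chain_catE[z xz [/= zp py]].
rewrite cost_cat cost_cons size_cat /= => sk sn.
have := cost_ge0 s1; have := cost_ge0 s2; have := half0 p.1 => p0 s20 s10.
(* Otherwise this step alone would cost at least [2^-1 ^+ k], which the whole chain does not. *)
have kp : (k < p.1)%N.
  rewrite ltnNge; apply/negP => pk.
  have : 2^-1 ^+ k <= 2^-1 ^+ p.1 :> K by apply: ler_wiXn2l => //; lra.
  by lra.
apply: (@E_comp3 _ _ z p.2).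
- by apply: IHn xz s1k; lia.
- exact: entourage_sub zp.
- apply: IHn py _; first by lia.
  by case: s2k => [->|]; [rewrite cost_nil|move: sk; rewrite exprS; lra].
Qed.

Lemma chain_costs_has_inf x y :
  has_inf [set cost s | s in [set s | chain x s y]].
Proof.
split; last by exists 0 => _ [s _ <-]; exact: cost_ge0.
by exists (cost [:: (0%N, y)]), [:: (0%N, y)].
Qed.

Lemma chain_dist_le x y s : chain x s y -> chain_dist x y <= cost s.
Proof.
move=> xy; apply: ge_inf; last by exists s.
by have [] := chain_costs_has_inf x y.
Qed.

Lemma chain_dist_ge0 x y : 0 <= chain_dist x y.
Proof.
apply: lb_le_inf; first by have [] := chain_costs_has_inf x y.
by move=> _ [s _ <-]; exact: cost_ge0.
Qed.

Lemma chain_dist_refl x : chain_dist x x = 0.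
Proof.
apply/eqP; rewrite eq_le chain_dist_ge0 andbT.
by have := @chain_dist_le x x [::] erefl; rewrite cost_nil.
Qed.

Lemma chain_dist_sym x y : chain_dist x y = chain_dist y x.
Proof.
wlog suff: x y / chain_dist x y <= chain_dist y x.
  by move=> le_d; apply/eqP; rewrite eq_le !le_d.
apply: lb_le_inf; first by have [] := chain_costs_has_inf y x.
by move=> _ [s /chain_rev[t xy <-] <-]; exact: chain_dist_le.
Qed.

(** Concatenating chains adds their costs; the two infima are handled one at a time. *)
Lemma chain_dist_triangle x y z :
  chain_dist x z <= chain_dist x y + chain_dist y z.
Proof.
rewrite -lerBlDr; apply: lb_le_inf.
  by have [] := chain_costs_has_inf x y.
move=> _ [s xy <-]; rewrite lerBlDr addrC -lerBlDr; apply: lb_le_inf.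
  by have [] := chain_costs_has_inf y z.
move=> _ [t yz <-]; rewrite lerBlDr addrC -cost_cat.
exact/chain_dist_le/chain_cat/yz.
Qed.

Lemma entourage_chain_dist k x y : E k x y -> chain_dist x y <= 2^-1 ^+ k.
Proof.
move=> xy; have := @chain_dist_le x y [:: (k, y)].
by rewrite cost_cons cost_nil addr0; apply.
Qed.

(** An infimum below [2^-1 ^+ k] is witnessed by a chain of cost below it. Together with
    [entourage_chain_dist] this compares entourages with balls. *)
Lemma chain_dist_entourage k x y : chain_dist x y < 2^-1 ^+ k -> E k x y.
Proof.
by move=> /(inf_lt (chain_costs_has_inf x y).1)[_ [s xy <-]];
  exact: chain_entourage.
Qed.

End Frink.

(** * Integer iterates, compactness by covers, and chains of closures *)

Lemma zpowS (X : topologicalType) (f : homeo X X) (n : int) x :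
  zpow f (n + 1) x = f (zpow f n x).
Proof.
case: n => [n|[|n]].
- by rewrite (_ : _ + 1 = Posz n.+1)//; lia.
- by rewrite /= homeoVK.
- by rewrite (_ : _ + 1 = Negz n)//=; [rewrite homeoVK|lia].
Qed.

Lemma zpowD (X : topologicalType) (f : homeo X X) (m n : int) x :
  zpow f (m + n) x = zpow f m (zpow f n x).
Proof.
elim/int_ind: m => [|m IHm|m IHm]; first by rewrite add0r.
  rewrite (_ : (m.+1 : int) + n = m%:Z + n + 1); last by lia.
  by rewrite zpowS IHm.
(* For negative exponents, both sides are compared after one more application of [f]. *)
apply: (can_inj (homeoK f)); rewrite -!zpowS.
rewrite (_ : - m.+1%:Z + n + 1 = - m%:Z + n); last by lia.
by rewrite (_ : - m.+1%:Z + 1 = - m%:Z); last by lia.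
Qed.

Lemma zpow_continuous (X : topologicalType) (f : homeo X X) (n : int) :
  continuous (zpow f n).
Proof.
have iter_continuous (g : X -> X) k : continuous g -> continuous (iter k g).
  move=> cg; elim: k => [|k IHk] x /=; first exact: cvg_id.
  exact: continuous_comp (IHk x) (cg _).
case: n => n; apply: iter_continuous.
- exact: homeo_continuous.
- exact: homeoV_continuous.
Qed.

Lemma zpow_quot (X : topologicalType) (f : homeo X X) (R : equiv_rel X)
    (fR : compatible f R) (n : int) x :
  zpow (quot_homeo fR) n (\pi_(quot_space R) x) =
  \pi_(quot_space R) (zpow f n x).
Proof.
by case: n => n; rewrite /zpow; [|move: n.+1 => {}n]; elim: n => //= n ->;
  rewrite ?(quot_funE fR) ?(quot_invE fR).
Qed.

(* [compact_cover] is only stated for pointed spaces. *)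
Lemma compact_cover_compact (X : topologicalType) :
  compact [set: X] -> cover_compact [set: X].
Proof.
have [[x0 _]|X0] := pselect (exists x : X, True); last first.
  move=> _ I D F _ _; exists fset0 => // x; by exfalso; apply: X0; exists x.
pose Y : ptopologicalType :=
  HB.pack (Topological.sort X) X (isPointed.Build X x0).
by have := @compact_cover Y; rewrite predeqE => /(_ setT) YE; exact: YE.1.
Qed.

(** The set is a finite union of closed squares, one for each member of [C]. *)
Lemma refines_into_closed (X : topologicalType) (C : set (set X)) :
  finite_set C -> (forall B, C B -> closed B) ->
  closed [set p : X * X | refines_into [set p.1; p.2] C].
Proof.
move=> finC clC.
rewrite (_ : [set p | _] = \bigcup_(B in C) (B `*` B)).
  apply: closed_bigcup => // B /clC clB.
  rewrite (_ : B `*` B = fst @^-1` B `&` snd @^-1` B) //.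
  by apply: closedI; apply: closed_comp => // ? _;
    [exact: cvg_fst|exact: cvg_snd].
apply/seteqP; split=> -[x y] /= [B CB sB]; exists B => //.
  by split=> /=; apply: sB; [left|right].
by case: sB => /= Bx By z [->|->].
Qed.

(** The family lies in the image of a fourfold product of a finite set under union. *)
Lemma chain_pow_closures_finite (X : topologicalType) (U : set (set X)) :
  finite_set U -> finite_set (chain_pow (closures U) 4).
Proof.
move=> finU; pose V := closures U.
have finV : finite_set V by exact: finite_image.
apply: (@sub_finite_set _ _ ((fun p : (set X * set X) * (set X * set X) =>
  p.1.1 `|` p.1.2 `|` p.2.1 `|` p.2.2) @` ((V `*` V) `*` (V `*` V)))); last first.
  by apply: finite_image; do !apply: finite_setX.
move=> _ [C [VC _ ->]]; exists ((C 0%N, C 1%N), (C 2%N, C 3%N)).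
  by split; split; apply: VC.
apply/seteqP; split=> [x [[[]|]|]|x [[|[|[|[]]]]// _]] /=.
all: by [exists 0%N|exists 1%N|exists 2%N|exists 3%N
  |do 3?left|do 2?left; right|left; right|right].
Qed.

Lemma chain_pow_closures_closed (X : topologicalType) (U : set (set X)) B :
  chain_pow (closures U) 4 B -> closed B.
Proof.
move=> [C [VC _ ->]]; apply: closed_bigcup; first exact: finite_II.
by move=> i /VC[A _ <-]; exact: closed_closure.
Qed.

(** * Finite windows of iterates *)

Definition window_rel (X : topologicalType) (f : homeo X X) (C : set (set X))
    (M : nat) (x y : X) : Prop :=
  forall n : int, (`|n| <= M)%N -> refines_into [set zpow f n x; zpow f n y] C.

Section Window.
Variables (X : topologicalType) (compactX : compact [set: X]) (f : homeo X X).
Variable U : set (set X).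
Hypotheses (coverU : finite_open_cover U) (semiU : semi_expansive f U).

Let openU B : U B -> open B. Proof. by have [_ + _] := coverU; apply. Qed.

Let in_cover x : exists2 B, U B & B x.
Proof. by have [_ _ UT] := coverU; have : cover U id x by rewrite UT. Qed.

Lemma refines_into_sym (C : set (set X)) x y :
  refines_into [set x; y] C -> refines_into [set y; x] C.
Proof. by rewrite setUC. Qed.

Lemma window_rel_refl M x : window_rel f U M x x.
Proof.
by move=> n _; have [B UB Bx] := in_cover (zpow f n x);
  exists B => // z [->|->].
Qed.

Lemma window_rel_sym M x y : window_rel f U M x y -> window_rel f U M y x.
Proof. by move=> xy n /xy; exact: refines_into_sym. Qed.

Lemma near_refines_into (n : int) x :
  \forall y \near x, refines_into [set zpow f n x; zpow f n y] U.
Proof.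
have [B UB Bx] := in_cover (zpow f n x).
have : \forall y \near x, B (zpow f n y).
  by apply: (@zpow_continuous _ f n x); exact: open_nbhs_nbhs (conj (openU UB) Bx).
by apply: filterS => y By; exists B => // z [->|->].
Qed.

Lemma near_window_rel M x : \forall y \near x, window_rel f U M x y.
Proof.
elim: M => [|M IHM].
  by apply: filterS (near_refines_into 0 x) => y xy n;
    rewrite leqn0 absz_eq0 => /eqP ->.
(* Widening the window by one adds only the exponents [M.+1] and [Negz M], its opposite. *)
apply: filterS3 IHM (near_refines_into M.+1%:Z x)
  (near_refines_into (Negz M) x).
move=> y xyM xyp xyn n nM; have [/xyM//|Mn] := leqP `|n|%N M.
by have [->//|->//] : n = M.+1%:Z \/ n = Negz M by lia.
Qed.

(** Semi-expansiveness becomes uniform: each pair has a neighbourhood and a bound past which the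
    implication holds, and compactness of [X * X] gives a common bound. *)
Lemma semi_expansive_window : exists2 N, (0 < N)%N & forall x y,
  window_rel f (chain_pow (closures U) 4) N x y -> refines_into [set x; y] U.
Proof.
set C := chain_pow _ _.
have [finU _ _] := coverU.
have clC : closed [set p : X * X | refines_into [set p.1; p.2] C].
  apply: refines_into_closed; first exact: chain_pow_closures_finite.
  exact: chain_pow_closures_closed.
have /compact_near_coveringP/(_ nat \oo (fun N p =>
    window_rel f C N p.1 p.2 -> refines_into [set p.1; p.2] U)) :
    compact [set: X * X].
  by rewrite -setXTT; exact: compact_setX.
case => [[x y] _|N _ NP]; last first.
  by exists N.+1 => // x y xy; exact: (NP N.+1 (leqnSn N) (x, y) I xy).
(* A pair related at all times lies, by semi-expansiveness, in an open square over a member of [U],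
   where the conclusion holds for every [N]. *)
have [xyC|/existsNP[n nxyC]] := pselect (cover_rel f C x y).
  have [B UB sB] := semiU xyC 0.
  exists ([set p : X * X | B p.1 /\ B p.2], setT) => /=; last first.
    by move=> [[x' y'] N] [[/= Bx' By'] _] _; exists B => // z [->|->].
  split; last exact: filterT.
  exists (B, B) => //=; split; apply: open_nbhs_nbhs; split; try exact: openU.
    by apply: sB; left.
  by apply: sB; right.
(* A pair failing at time [n] keeps failing nearby because [clC] makes failure open, so the premise
   is false once [N] is at least [|n|]. *)
exists ([set p : X * X | ~ refines_into [set zpow f n p.1; zpow f n p.2] C],
   [set N | (`|n| <= N)%N]) => /=; last first.
  by move=> [[x' y'] N] [/= nC nN] /(_ n nN).
split; last by exists `|n|%N.
have cn : {for (x, y), continuous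
    (fun p : X * X => (zpow f n p.1, zpow f n p.2))}.
  apply: cvg_pair => /=.
    by apply: (cvg_comp fst (zpow f n)); [exact: cvg_fst|exact: zpow_continuous].
  by apply: (cvg_comp snd (zpow f n)); [exact: cvg_snd|exact: zpow_continuous].
apply: (cn [set p | ~ refines_into [set p.1; p.2] C]).
by apply: open_nbhs_nbhs; split=> //; exact: closed_openC clC.
Qed.

(* Level [0] is the total relation, so that any two points are joined by a
   chain. *)
Definition window_entourage (N k : nat) (x y : X) : Prop :=
  if k is k'.+1 then window_rel f U (k' * N) x y else True.

(** The members of [U] containing the three pairs at time [n + m] meet at the images of [y] and [z],
    so their closures form a chain from [x] to [w]. The margin [N] leaves room for all times [n]
    that [UN] inspects. *)
Lemma window_rel_comp3 N M x y z w :
  (forall x y,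
    window_rel f (chain_pow (closures U) 4) N x y -> refines_into [set x; y] U) ->
  window_rel f U (M + N) x y -> window_rel f U (M + N) y z ->
  window_rel f U (M + N) z w -> window_rel f U M x w.
Proof.
move=> UN xy yz zw m mM; apply: UN => n nN.
rewrite -!zpowD.
have mnMN : (`|(n + m)%R| <= M + N)%N by lia.
have [A UA sA] := xy _ mnMN; have [B UB sB] := yz _ mnMN.
have [D UD sD] := zw _ mnMN.
(* A chain of exactly four closures is required, so the last one is repeated. *)
exists (\bigcup_(i < 4)
  nth set0 [:: closure A; closure B; closure D; closure D] i).
  exists (nth set0 [:: closure A; closure B; closure D; closure D]).
  split=> // [[|[|[|[|//]]]]|[|[|[|//]]]] _ /=.
  - by exists A.
  - by exists B.
  - by exists D.
  - by exists D.
  - exists (zpow f (n + m) y).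
    by split; apply: subset_closure; [apply: sA; right|apply: sB; left].
  - exists (zpow f (n + m) z).
    by split; apply: subset_closure; [apply: sB; right|apply: sD; left].
  - exists (zpow f (n + m) z).
    by split; apply: subset_closure; apply: sD; left.
move=> _ [->|->]; [exists 0%N|exists 2%N] => //=; apply: subset_closure.
  by apply: sA; left.
by apply: sD; right.
Qed.

End Window.

(** * The metric induced on the quotient *)

Section QuotientMetric.
Variables (K : realType) (X : topologicalType) (compactX : compact [set: X]).
Variables (R : equiv_rel X) (d : X -> X -> K).
Hypotheses (d_ge0 : forall x y, 0 <= d x y)
  (d_eq0 : forall x y, d x y = 0 <-> R x y)
  (d_sym : forall x y, d x y = d y x)
  (d_triangle : forall x y z, d x z <= d x y + d y z)
  (d_near : forall x e, 0 < e -> \forall y \near x, d x y < e).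

Definition quot_dist (p q : quot_space R) : K := d (repr p) (repr q).

(** A chosen representative is at distance zero from the point, and the triangle inequality absorbs
    the change. *)
Lemma quot_distE x y :
  quot_dist (\pi_(quot_space R) x) (\pi_(quot_space R) y) = d x y.
Proof.
have d_repr z : d (repr (\pi_(quot_space R) z)) z = 0.
  by apply/d_eq0/quot_spaceP; rewrite reprK.
rewrite /quot_dist; set x' := repr _; set y' := repr _.
have := d_repr x; have := d_repr y; rewrite -/x' -/y' => yy xx.
have := d_triangle x' x y'; have := d_triangle x y y'.
have := d_triangle x x' y; have := d_triangle x' y' y.
by rewrite (d_sym y y') (d_sym x x') xx yy; lra.
Qed.

Lemma quot_dist_metric : is_metric quot_dist.
Proof.
split=> [p q|p q|p q|p q r]; [exact: d_ge0| |exact: d_sym|exact: d_triangle].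
rewrite -[p]reprK -[q]reprK quot_distE; split=> [/d_eq0/quot_spaceP//|].
by move=> /quot_spaceP/d_eq0.
Qed.

(* The quotient map is a continuous bijection from a compact space onto the
   metric space, hence a homeomorphism. *)
Lemma quot_dist_topology : induces_topology quot_dist.
Proof.
move=> A; split=> [oA p Ap|dA]; last first.
  rewrite /open/= /quotient_open openE => x /= Ax.
  have [e e0 eA] := dA _ Ax.
  by apply: filterS (d_near x e0) => y xy; apply: eA; rewrite /= quot_distE.
have : compact (~` (\pi_(quot_space R) @^-1` A)).
  by apply: (subclosed_compact _ compactX) => //; exact: open_closedC.
move=> /compact_near_coveringP/(_ K 0^'+ (fun e y => e <= d (repr p) y)) nc.
(* The distance to [repr p] is positive on the compact complement of the preimage of [A];
   compactness gives one lower bound [e]. *)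
have pA : \forall e \near 0^'+,
    ~` (\pi_(quot_space R) @^-1` A) `<=` [set y | e <= d (repr p) y].
  apply: nc => y nAy.
  have py : 0 < d (repr p) y.
    rewrite lt_neqAle d_ge0 andbT eq_sym; apply/eqP => /d_eq0/quot_spaceP.
    by rewrite reprK => pE; apply: nAy; rewrite /preimage/= -pE.
  (* Points closer to [y] than half the distance stay farther than the other half from [repr p]. *)
  have h0 : 0 < d (repr p) y / 2 by lra.
  exists ([set y' | d y y' < d (repr p) y / 2],
    [set e | e < d (repr p) y / 2]) => /=.
    by split; [exact: d_near|exact: nbhs_right_lt].
  move=> [y' e] [/= yy' ey]; have := d_triangle (repr p) y' y.
  by rewrite (d_sym y' y); lra.
have [e [eA e0]] := filter_ex (filterI pA (nbhs_right_gt (0 : K))).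
exists e => // q pq; apply: contrapT => nAq; have := eA (repr q).
by rewrite /= reprK => /(_ nAq); rewrite leNgt pq.
Qed.

End QuotientMetric.

(** * From a semi-expansive cover to an expansive quotient *)

Section ExpansiveOfSemiExpansive.
Variables (K : realType) (X : topologicalType) (compactX : compact [set: X]).
Variables (f : homeo X X) (R : equiv_rel X) (fR : compatible f R).
Variable U : set (set X).

Lemma expansive_of_semi_expansive :
  finite_open_cover U -> semi_expansive f U ->
  (forall x y : X, R x y <-> cover_rel f U x y) -> expansive K (quot_homeo fR).
Proof.
move=> coverU semiU RU.
have [N N0 UN] := semi_expansive_window compactX coverU semiU.
pose E := window_entourage f U N.
have E_refl k x : E k x x by case: k => // k; exact: window_rel_refl.
have E_sym k x y : E k x y -> E k y x by case: k => // k; exact: window_rel_sym.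
have E_comp3 k x y z w : E k.+1 x y -> E k.+1 y z -> E k.+1 z w -> E k x w.
  (* The window [k.+1 * N] is [k * N] with a margin of [N], as [window_rel_comp3] asks. *)
  case: k => // k; rewrite /E /= mulSn addnC; exact: window_rel_comp3.
have E_total x y : E 0 x y by [].
pose d := @chain_dist K X E.
have d_small k x y : d x y < 2^-1 ^+ k -> E k x y.
  exact: chain_dist_entourage.
have d_ge0 x y : 0 <= d x y by exact: chain_dist_ge0.
have geom e : 0 < e -> exists k, 2^-1 ^+ k < e :> K.
  move=> e0; have [k] := filter_ex (near_infty_natSinv_expn_lt (PosNum e0)).
  by rewrite mul1r -exprVn; exists k.
have d_eq0 x y : d x y = 0 <-> R x y.
  split=> [xy|/RU xy].
    (* Level [|n|.+1] has window [|n| * N], which contains [n] because [N] is positive. *)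
    apply/RU => n; have : E `|n|.+1 x y by apply: d_small; rewrite xy exprn_gt0.
    by apply; rewrite leq_pmulr.
  (* Points related by [R] lie in every entourage, so their distance is at most every
     [2^-1 ^+ k]. *)
  apply/eqP; rewrite eq_le d_ge0 andbT; apply/ler_addgt0Pr => e /geom[k ke].
  rewrite add0r.
  apply: le_trans (ltW ke); apply: entourage_chain_dist => //.
  by case: k {ke} => // k n _; exact: xy.
have d_sym x y : d x y = d y x by exact: chain_dist_sym.
have d_triangle x y z : d x z <= d x y + d y z by exact: chain_dist_triangle.
have d_near x e : 0 < e -> \forall y \near x, d x y < e.
  move=> /geom[k ke]; have : \forall y \near x, E k x y.
    by case: k {ke} => [|k]; [exact: filterT|exact: near_window_rel].
  apply: filterS => y xy; apply: le_lt_trans ke.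
  exact: entourage_chain_dist.
exists (quot_dist d (R := R)); split.
- exact: quot_dist_metric.
- exact: quot_dist_topology.
(* Since [1/4] is strictly below [1/2], a pair within this bound lies in level [1], whose window is
   the single exponent [0]. *)
- exists (4^-1); first by rewrite invr_gt0.
  move=> p q; rewrite -[p]reprK -[q]reprK => pq.
  apply/quot_spaceP/RU => n; have : E 1 (zpow f n (repr p)) (zpow f n (repr q)).
    apply: d_small; have := pq n; rewrite !zpow_quot quot_distE//.
    by rewrite expr1 => /le_lt_trans; apply; lra.
  by move=> /(_ 0); apply.
Qed.

End ExpansiveOfSemiExpansive.

(** * From an expansive quotient to a semi-expansive cover *)

Section SemiExpansiveOfExpansive.
Variables (K : realType) (X : topologicalType) (compactX : compact [set: X]).
Variables (f : homeo X X) (R : equiv_rel X) (fR : compatible f R).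

Section Balls.
Variables (d : quot_space R -> quot_space R -> K).
Hypotheses (d_metric : is_metric d) (d_top : induces_topology d).

Definition preball (r : K) (c : quot_space R) : set X :=
  [set x | d c (\pi_(quot_space R) x) < r].

Lemma preball_open r c : open (preball r c).
Proof.
have : open [set q : quot_space R | d c q < r].
  apply/d_top => q /= cq; exists (r - d c q); first by rewrite subr_gt0.
  by move=> q' /= qq'; have := Defs.metric_triangle d_metric c q q'; lra.
by apply.
Qed.

(** The preimage of the complement of the closed ball is open and misses [preball r c]. *)
Lemma closure_preball r c :
  closure (preball r c) `<=` [set x | d c (\pi_(quot_space R) x) <= r].
Proof.
have oC : open [set q : quot_space R | r < d c q].
  apply/d_top => q /= cq; exists (d c q - r); first by rewrite subr_gt0.
  move=> q' /= qq'; have := Defs.metric_triangle d_metric c q' q.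
  by rewrite (Defs.metric_sym d_metric q' q); lra.
move=> x cx /=; rewrite leNgt; apply/negP => rx.
have [|y [/= yr]] := cx [set x | r < d c (\pi_(quot_space R) x)].
  by apply: open_nbhs_nbhs; split=> //; exact: oC.
by rewrite ltNge (ltW yr).
Qed.

(** Walking along the chain through points where consecutive members meet costs at most [r] per
    member, and at most [k] members are visited. *)
Lemma chain_pow_dist (V : set (set X)) (r : K) k B x y :
  (forall A x y, V A -> A x -> A y ->
    d (\pi_(quot_space R) x) (\pi_(quot_space R) y) <= r) ->
  0 <= r -> chain_pow V k B -> B x -> B y ->
  d (\pi_(quot_space R) x) (\pi_(quot_space R) y) <= r *+ k.
Proof.
move=> Vr r0 [C [VC meetC ->]] [i ik Cx] [j jk Cy].
have steps m i' x' y' : (i' + m < k)%N -> C i' x' -> C (i' + m)%N y' ->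
    d (\pi_(quot_space R) x') (\pi_(quot_space R) y') <= r *+ m.+1.
  elim: m i' x' => [|m IHm] i' x' imk Cx' Cy'.
    rewrite addn0 in imk Cy'; exact: Vr (VC _ imk) Cx' Cy'.
  have i1k : (i'.+1 < k)%N by lia.
  have [z [Cz C1z]] := meetC _ i1k.
  have := Defs.metric_triangle d_metric (\pi_(quot_space R) x')
    (\pi_(quot_space R) z) (\pi_(quot_space R) y').
  move=> /le_trans; apply; rewrite mulrS; apply: lerD.
    exact: Vr (VC _ (ltnW i1k)) Cx' Cz.
  by apply: (IHm i'.+1) => //; rewrite addSnnS.
wlog ij : i j x y ik jk Cx Cy / (i <= j)%N.
  move=> le; have [ij|ji] := leqP i j; first exact: (le i j).
  by rewrite (Defs.metric_sym d_metric); apply: (le j i) => //; exact: ltnW.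
apply: (@le_trans _ _ (r *+ (j - i).+1)).
  by apply: (steps _ i) => //; rewrite subnKC.
by apply: ler_wpMn2l => //; simpl in *; lia.
Qed.

End Balls.

Lemma semi_expansive_of_expansive : expansive K (quot_homeo fR) ->
  exists U : set (set X), [/\ finite_open_cover U, semi_expansive f U &
    forall x y : X, R x y <-> cover_rel f U x y].
Proof.
(* Closures of balls of radius [r] have diameter at most [2r], so a chain of four has diameter at
   most [8r = a]. *)
move=> [d [dm dt [a a0 da]]]; pose r := a / 8.
have r0 : 0 < r by rewrite /r; lra.
have [|x _|D _ cD] := @compact_cover_compact _ compactX _ setT (preball d r).
- by move=> c _; exact: preball_open.
- exists (\pi_(quot_space R) x) => //=; rewrite /preball/=.
  by rewrite (iffRL (Defs.metric_eq0 dm _ _) erefl).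
pose U := [set preball d r c | c in [set` D]].
have diamU A x y : closures U A -> A x -> A y ->
    d (\pi_(quot_space R) x) (\pi_(quot_space R) y) <= r *+ 2.
  move=> [_ [c _ <-] <-] /(closure_preball dm dt)/= cx
    /(closure_preball dm dt)/= cy.
  have := Defs.metric_triangle dm (\pi_(quot_space R) x) c
    (\pi_(quot_space R) y).
  by rewrite (Defs.metric_sym dm _ c); lra.
have pow_le B x y : chain_pow (closures U) 4 B -> B x -> B y ->
    d (\pi_(quot_space R) x) (\pi_(quot_space R) y) <= a.
  move=> CB Bx By; rewrite (_ : a = (r *+ 2) *+ 4); last by rewrite /r; lra.
  by apply: (chain_pow_dist dm diamU _ CB) => //; rewrite mulrn_wge0// ltW.
have powR x y : cover_rel f (chain_pow (closures U) 4) x y -> R x y.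
  move=> xy; apply/quot_spaceP/da => n; rewrite !zpow_quot.
  by have [B CB sB] := xy n; apply: (pow_le B) => //; apply: sB; [left|right].
have RU x y : R x y -> cover_rel f U x y.
  (* Points of one class have the same image in the quotient at every time, so a ball containing one
     contains the other. *)
  move=> /quot_spaceP xy n; have [c /= Dc cx] := cD (zpow f n x) I.
  exists (preball d r c); first by exists c.
  by move=> _ [->//|->]; rewrite /preball/= -zpow_quot -xy zpow_quot.
exists U; split; [split| |].
- exact: finite_image (finite_fset D).
- by move=> _ [c _ <-]; exact: preball_open.
- apply/seteqP; split=> // x _; have [c Dc cx] := cD x I.
  by exists (preball d r c) => //; exists c.
- by move=> x y /powR/RU.
- move=> x y; split=> [/RU//|xy]; apply: powR => n; have [B UB sB] := xy n.
  (* The closure of one member is itself a chain: the constant one, whose links meet at the image of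
     [x]. *)
  exists (closure B); last by move=> z /sB; exact: subset_closure.
  exists (fun=> closure B); split=> [i _|i _|]; first by exists B.
    by rewrite setIid; exists (zpow f n x); apply/subset_closure/sB; left.
  by apply/seteqP; split=> [z Bz|z [i _]//]; exists 0%N.
Qed.

End SemiExpansiveOfExpansive.

Unset Implicit Arguments.
Set Strict Implicit.

Theorem theorem3p20 (K : realType) (X : topologicalType)
    (compactX : compact [set: X]) (f : homeo X X) (R : equiv_rel X)
    (fR : compatible f R) :
  expansive K (quot_homeo fR) <->
  exists U : set (set X), [/\ finite_open_cover U, semi_expansive f U &
    forall x y : X, R x y <-> cover_rel f U x y].
Proof.
split; first exact: semi_expansive_of_expansive.
by move=> [U [coverU semiU RU]]; exact: expansive_of_semi_expansive RU.
Qed.
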